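(* Let $\mathcal{H}$ be a real Hilbert space, let $f\colon\mathcal{H}\to\mathbb{R}\cup\{\pm\infty\}$ be a proper closed convex function, and let $S_f$ be any affine support set of $f$. Let $a_f = \sup\{a \mid (a, 0) \in S_f\}$ (with $a_f=-\infty$ if there is no such $a$). Let $$N_f = \{ (b, w) \in \mathbb{R} \times \mathcal{H} \mid b( a - a_f ) + \langle w, v \rangle \le 0 \ \ \forall (a, v) \in S_f \}$$ if $S_f\cap(\mathbb{R}\times\{0\})\ne\emptyset$, and $N_f=\emptyset$ otherwise. The following statements hold true: 1. $f$ is bounded below iff $S_f \cap (\mathbb{R} \times \{ 0 \}) \ne \emptyset$; 2. if $f$ is bounded below, then $a_f = \inf_{x \in \mathcal{H}} f(x)$; 3. $f$ attains a global minimum iff there exists $(b, w) \in N_f$ such that $b > 0$; furthermore, $\operatorname{arg\,min}_{x \in \mathcal{H}} f(x) = \{ b^{-1} w \in \mathcal{H} \mid (b, w) \in N_f,\ b > 0 \}$; 4. if $f(x) \ge 0$ for all $x \in \mathcal{H}$, then either $0 \in S_f$ or $a_* > 0$, where $(a_*, v_* )$ is the globally optimal solution of the problem $$\min_{(a, v) \in \mathbb{R} \times \mathcal{H}} \| (a, v) \|^2 \quad \text{subject to} \quad (a, v) \in S_f;$$ conversely, if $f$ is bounded below and either $0 \in S_f$ or $a_* > 0$, then $f(x) \ge 0$ for all $x \in \mathcal{H}$. Moreover, in the case $a_* > 0$ (with $f$ bounded below) one has $a_f > 0$, i.e. $\inf_{x \in \mathcal{H}} f(x) > 0$.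
   Context: ''Closed'' means lower semicontinuous. $\mathbb{R}\times\mathcal{H}$ carries the norm $\|(a,v)\| = \sqrt{a^2+\|v\|^2}$. An affine support set of a proper closed convex function $f$ is any closed convex set $S_f\subset\mathbb{R}\times\mathcal{H}$ such that $f(x)=\sup_{(a,v)\in S_f}(a+\langle v,x\rangle)$ for all $x\in\mathcal{H}$. *)

(* Defs.v *)
From HB Require Import structures.
From mathcomp Require Import all_boot all_order all_algebra sesquilinear.
From mathcomp Require Import all_classical all_reals all_analysis.

Set Implicit Arguments.
Unset Strict Implicit.
Unset Printing Implicit Defensive.

Import Order.TTheory GRing.Theory Num.Theory numFieldNormedType.Exports.
Local Open Scope classical_set_scope.
Local Open Scope ring_scope.

(* A real Hilbert space is a complete normed module H over R : realType together
   with a positive definite symmetric bilinear form ip that induces its norm. *)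
Definition induces_norm (R : realType) (H : completeNormedModType R)
    (ip : {dot H for idfun}) : Prop :=
  forall x : H, `|x| = Num.sqrt (ip x x).

Section ExtendedRealFunctions.
Variables (R : realType) (H : completeNormedModType R).
Implicit Type f : H -> \bar R.
Local Open Scope ereal_scope.

Definition eproper f : Prop :=
  (exists x, f x < +oo) /\ (forall x, -oo < f x).

(* Convexity through the epigraph, which avoids the convention +oo + -oo. *)
Definition econvex f : Prop :=
  convex_set [set p : H * R | f p.1 <= p.2%:E].

Definition bounded_below f : Prop := exists m : R, forall x, m%:E <= f x.

Definition argmin f : set H := [set x | forall y, f x <= f y].

Definition attains_min f : Prop := exists x, forall y, f x <= f y.

End ExtendedRealFunctions.

Section AffineSupport.
Variables (R : realType) (H : completeNormedModType R) (ip : {dot H for idfun}).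
Implicit Types (f : H -> \bar R) (S : set (R * H)).

(* The library norm on R * H is the max norm; it induces the same topology. *)
Definition norm2 (p : R * H) : R := Num.sqrt (p.1 ^+ 2 + `|p.2| ^+ 2).

Definition affine_support f S : Prop :=
  [/\ closed S, convex_set S &
      forall x, f x = ereal_sup [set (p.1 + ip p.2 x)%:E | p in S]].

Definition horizontal S : set (R * H) := S `&` (setT `*` [set 0]).

(* Equal to -oo when no (a, 0) lies in S, since ereal_sup set0 = -oo. *)
Definition height S : \bar R := ereal_sup [set a%:E | a in [set a | S (a, 0)]].

(* For S an affine support set of a proper function, [height S] is finite as
   soon as [horizontal S] is nonempty, so the product below is a real one. *)
Definition normal_set S : set (R * H) :=
  [set q : R * H | horizontal S !=set0 /\
    forall p, S p ->
      (q.1%:E * (p.1%:E - height S) + (ip q.2 p.2)%:E <= 0)%E].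

Definition min_norm S : set (R * H) :=
  [set p | S p /\ forall q, S q -> norm2 p ^+ 2 <= norm2 q ^+ 2].

End AffineSupport.

(* Main.v *)
(* Let f >= m.  The point p of minimal norm in the closure of the convex set
   C = {(a - t - m, v) | (a, v) in S, t >= 0} satisfies <p, p> <= <p, q> on C.
   If p were nonzero, then p.1 <= 0 since C is closed under decreasing the first
   coordinate, and this inequality forces f below m: at p.2 / p.1 if p.1 < 0,
   and far along - p.2 if p.1 = 0.  So S has points (a_n, v_n) with v_n -> 0 and
   liminf a_n >= m; the a_n are bounded above because f is finite somewhere,
   and closedness of S gives (a, 0) in S with a >= m.  This yields 1 and 2,
   and 3 follows by unfolding.  For 4, the minimal norm point p of S satisfies
   <p, p> <= p.1 * a for every (a, 0) in S. *)

Require Import Defs.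
From HB Require Import structures.
From mathcomp Require Import all_boot all_order all_algebra sesquilinear.
From mathcomp Require Import all_classical all_reals all_analysis.
From mathcomp Require Import ring lra.

Import Order.TTheory GRing.Theory Num.Theory numFieldNormedType.Exports.
Local Open Scope classical_set_scope.
Local Open Scope ring_scope.

Set Implicit Arguments.
Unset Strict Implicit.

(** * Euclidean geometry of the product of [R] and [H] *)

Section InnerProduct.
Variables (R : realType) (H : completeNormedModType R) (ip : {dot H for idfun}).
Hypothesis hip : induces_norm ip.

Lemma ipC x y : ip x y = ip y x.
Proof. by rewrite hermC /= expr0 mul1r. Qed.

Lemma ip_normE x : ip x x = `|x| ^+ 2.
Proof.
rewrite hip sqr_sqrtr//; have [->|x0] := eqVneq x 0; first by rewrite linear0.
exact/ltW/neq0_dnorm_gt0.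
Qed.

(** Expanding |x + y|^2 >= 0 gives this cheap substitute for Cauchy-Schwarz. *)
Lemma ip_ge_sqr x y : - (`|x| ^+ 2 + `|y| ^+ 2) / 2 <= ip x y.
Proof.
have := sqr_ge0 `|x + y|.
rewrite -!ip_normE linearDl /= !linearD /= (ipC y x); lra.
Qed.

(** The inner product whose norm is [norm2]; the max norm on [R * H] serves only for the
    topology. *)
Definition pdot (p q : R * H) : R := p.1 * q.1 + ip p.2 q.2.

Lemma pdotC p q : pdot p q = pdot q p.
Proof. by rewrite /pdot mulrC ipC. Qed.

Lemma pdotBr p q r : pdot p (q - r) = pdot p q - pdot p r.
Proof. by rewrite /pdot /= mulrBr linearB /= opprD addrACA. Qed.

Lemma pdotDr p q r : pdot p (q + r) = pdot p q + pdot p r.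
Proof. by rewrite /pdot /= mulrDr linearD /= addrACA. Qed.

Lemma pdotZr p t q : pdot p (t *: q) = t * pdot p q.
Proof. by rewrite /pdot /= linearZ /= mulrDr mulrCA. Qed.

Lemma pdot_normE p : pdot p p = p.1 ^+ 2 + `|p.2| ^+ 2.
Proof. by rewrite /pdot ip_normE expr2. Qed.

Lemma norm2E p : norm2 p ^+ 2 = pdot p p.
Proof. by rewrite pdot_normE sqr_sqrtr// addr_ge0// sqr_ge0. Qed.

Lemma pdot_ge0 p : 0 <= pdot p p.
Proof. by rewrite -norm2E sqr_ge0. Qed.

Lemma pdot_eq0 p : pdot p p <= 0 -> p = 0.
Proof.
rewrite pdot_normE => p0.
have h1 := sqr_ge0 p.1; have h2 := sqr_ge0 `|p.2|.
have /eqP e1 : p.1 ^+ 2 == 0 by rewrite eq_le h1 andbT; lra.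
have /eqP e2 : `|p.2| ^+ 2 == 0 by rewrite eq_le h2 andbT; lra.
move/eqP: e1; rewrite sqrf_eq0 => /eqP e1.
move/eqP: e2; rewrite sqrf_eq0 normr_eq0 => /eqP e2.
by rewrite [p]surjective_pairing e1 e2.
Qed.

Lemma pdot_segment p q t :
  pdot (p + t *: (q - p)) (p + t *: (q - p)) =
  pdot p p + 2 * t * (pdot p q - pdot p p) + t ^+ 2 * pdot (q - p) (q - p).
Proof.
rewrite -pdotBr; move: (q - p) => v.
rewrite pdotDr pdotZr 2!(pdotC (_ + _)) !pdotDr !pdotZr (pdotC v p).
by ring.
Qed.

(** The parallelogram law, in the form that makes minimizing sequences Cauchy. *)
Lemma pdot_sub_midpoint p q :
  pdot (q - p) (q - p) = 2 * (pdot p p + pdot q q) -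
    4 * pdot (p + 2^-1 *: (q - p)) (p + 2^-1 *: (q - p)).
Proof.
rewrite pdot_segment.
have -> : pdot (q - p) (q - p) = pdot q q - 2 * pdot p q + pdot p p.
  by rewrite pdotBr 2!(pdotC (_ - _)) !pdotBr (pdotC q p); ring.
by field.
Qed.

Lemma convex_set_segment (C : set (R * H)) p q t : convex_set C ->
  C p -> C q -> 0 <= t -> t <= 1 -> C (p + t *: (q - p)).
Proof.
move=> cC Cp Cq t0 t1.
have := cC q p (Itv01 t0 t1); rewrite !inE => /(_ Cq Cp); congr C.
rewrite [LHS](_ : _ = t *: (q : R * H) + (1 - t) *: (p : R * H))//.
by rewrite scalerBr scalerBl scale1r addrCA.
Qed.

Lemma pdot_continuous : continuous (fun p : R * H => pdot p p).
Proof.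
rewrite (eq_fun pdot_normE) => p.
by apply: cvgD; apply: cvgM; [exact: cvg_fst|exact: cvg_fst|
  apply: cvg_norm; exact: cvg_snd|apply: cvg_norm; exact: cvg_snd].
Qed.

Lemma pdot_lt_sqr p (e : R) :
  0 < e -> pdot p p < e ^+ 2 -> `|p.1| < e /\ `|p.2| < e.
Proof.
rewrite pdot_normE => e0 pe; have h1 := sqr_ge0 p.1; have h2 := sqr_ge0 `|p.2|.
split; rewrite -(@ltr_pXn2r _ 2)// ?nnegrE ?normr_ge0 ?ltW//.
  by rewrite real_normK ?num_real//; lra.
by lra.
Qed.

(** * Projection of the origin onto a convex set *)

Lemma inv_succ_lt (e : R) : 0 < e -> exists N, N.+1%:R^-1 < e.
Proof.
move=> e0; have [N _ /(_ N (leqnn _))] := near_infty_natSinv_lt (PosNum e0).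
by exists N.
Qed.

Lemma pdot_cauchy_cvg (u : nat -> R * H) :
  (forall n m, (n <= m)%N -> pdot (u n - u m) (u n - u m) <= 4 * n.+1%:R^-1) ->
  exists p : R * H, u @ \oo --> p.
Proof.
move=> uC.
have near_u e : 0 < e -> exists N, forall n, (N <= n)%N ->
    `|(u N - u n).1| < e /\ `|(u N - u n).2| < e.
  move=> e0; have [|N Ne] := @inv_succ_lt (e ^+ 2 / 4).
    by rewrite divr_gt0// exprn_gt0.
  exists N => n Nn; apply: pdot_lt_sqr => //.
  by apply: le_lt_trans (uC _ _ Nn) _; rewrite mulrC -ltr_pdivlMr.
have c1 : cvg ((fun n => (u n).1) @ \oo).
  apply: cauchy_cvg; apply: cauchy_exP => e e0.
  have [N uN] := near_u e e0; exists (u N).1; exists N => // n /= Nn.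
  by have [+ _] := uN n Nn.
have c2 : cvg ((fun n => (u n).2) @ \oo).
  apply: cauchy_cvg; apply: cauchy_exP => e e0.
  have [N uN] := near_u e e0; exists (u N).2; exists N => // n /= Nn.
  by rewrite -ball_normE /=; have [_ +] := uN n Nn.
exists (lim ((fun n => (u n).1) @ \oo), lim ((fun n => (u n).2) @ \oo)).
rewrite (_ : u = fun n => ((u n).1, (u n).2)); last first.
  by apply/funext => n; case: (u n).
by apply: (cvg_pair c1 c2).
Qed.

(** A minimizing sequence for [pdot q q] is Cauchy by the parallelogram law; its limit [p] satisfies
    the variational inequality because moving from [p] towards [q] cannot decrease the norm. *)
Lemma projection (C : set (R * H)) : convex_set C -> C !=set0 ->
  exists2 p, closure C p & forall q, C q -> pdot p p <= pdot p q.
Proof.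
move=> cC [c0 Cc0].
pose D : set R := [set pdot q q | q in C]; pose d := inf D.
have infD : has_inf D.
  split; first by exists (pdot c0 c0); exists c0.
  by exists 0 => _ [q _ <-]; exact: pdot_ge0.
have dle q : C q -> d <= pdot q q.
  by move=> Cq; apply: ge_inf; [exact: infD.2|exists q].
have [u uP] : {u : nat -> R * H &
    forall n, C (u n) /\ pdot (u n) (u n) < d + n.+1%:R^-1}.
  apply: (@choice _ _ (fun n q => C q /\ pdot q q < d + n.+1%:R^-1)) => n.
  have n0 : 0 < n.+1%:R^-1 :> R by rewrite invr_gt0.
  by have [_ [q Cq <-] ?] := inf_adherent n0 infD; exists q.
have [p up] : exists p : R * H, u @ \oo --> p.
  apply: pdot_cauchy_cvg => n m nm.
  have [Cn un] := uP n; have [Cm um] := uP m.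
  have h : (0 : R) <= 2^-1 /\ 2^-1 <= (1 : R) by split; lra.
  have := dle _ (convex_set_segment cC Cm Cn h.1 h.2).
  have : m.+1%:R^-1 <= n.+1%:R^-1 :> R by rewrite lef_pV2 ?posrE// ler_nat.
  (* Both squared norms are nearly [d] and the midpoint has at least [d], so the [d] terms cancel
     and 2x + 2y <= 4x remains. *)
  have aux (a b c e x y : R) : a < e + x -> b < e + y -> y <= x -> e <= c ->
    2 * (b + a) - 4 * c <= 4 * x by lra.
  by rewrite pdot_sub_midpoint => nm' dm; apply: aux un um nm' dm.
have cpt t c : continuous
    (fun z : R * H => pdot (z + t *: (c - z)) (z + t *: (c - z))).
  move=> z; apply: (@continuous_comp _ _ _ (fun z : R * H => z + t *: (c - z))
    (fun z => pdot z z)); last exact: pdot_continuous.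
  apply: cvgD; first exact: cvg_id.
  by apply: cvgZr; apply: cvgB; [exact: cvg_cst|exact: cvg_id].
(* As [p] may lie outside [C], the bound is proved on segments from [u n] to [q] and passed to the
   limit. *)
have dp q t : C q -> 0 <= t -> t <= 1 ->
    d <= pdot (p + t *: (q - p)) (p + t *: (q - p)).
  move=> Cq t0 t1; have cu := cvg_comp _ _ up (cpt t q p).
  apply: (closed_cvg (fun x : R => d <= x)) cu; first exact: closed_ge.
  by apply: nearW => n /=; apply: dle; apply: convex_set_segment => //;
    have [] := uP n.
have pd : pdot p p <= d.
  apply/ler_addgt0Pr => e e0.
  have cu := cvg_comp _ _ up (@pdot_continuous p).
  apply: (closed_cvg (fun x : R => x <= d + e)) cu; first exact: closed_le.
  have [N Ne] := inv_succ_lt e0; exists N => // n /= Nn.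
  have [_ /ltW/le_trans] := uP n; apply.
  rewrite lerD2l (le_trans _ (ltW Ne))// lef_pV2 ?posrE// ler_nat//.
exists p.
  apply: (closed_cvg (closure C)) up; first exact: closed_closure.
  by apply: nearW => n; apply: subset_closure; have [] := uP n.
move=> q Cq; rewrite leNgt; apply/negP => lt.
have E0 := pdot_ge0 (q - p).
set E := pdot (q - p) (q - p) in E0.
pose s := pdot p p - pdot p q; have s0 : 0 < s by rewrite /s subr_gt0.
(* Minimality will give 2s <= tE, whereas this choice makes tE = s - ts < s. It also keeps [t] at
   most 1. *)
pose t := s / (E + s).
have Es : 0 < E + s by lra.
have t0 : 0 < t by rewrite divr_gt0.
have t1 : t <= 1 by rewrite ler_pdivrMr// mul1r; lra.
have := dp q t Cq (ltW t0) t1.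
rewrite pdot_segment -/E => h.
have tE : t * (E + s) = s by rewrite /t divfK// gt_eqF.
have : t * (2 * s) <= t * (t * E) by rewrite /s; lra.
rewrite ler_pM2l// => h2.
have := mulr_gt0 t0 s0; lra.
Qed.

(** * Lower bounds of a function and its affine support set *)

Section Support.
Variables (f : H -> \bar R) (S : set (R * H)).
Hypotheses (f_proper : eproper f) (hS : affine_support ip f S).

Lemma support_ub p x : S p -> ((p.1 + ip p.2 x)%:E <= f x)%E.
Proof. by case: hS => _ _ -> Sp; apply: ereal_sup_ubound; exists p. Qed.

Lemma support_le x y :
  (forall p, S p -> ((p.1 + ip p.2 x)%:E <= y)%E) -> (f x <= y)%E.
Proof.
by case: hS => _ _ -> Sy; apply: ge_ereal_sup => _ [p Sp <-]; exact: Sy.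
Qed.

Lemma support_nonempty : S !=set0.
Proof.
apply/set0P/eqP => S0; have [[x _] /(_ x)] := f_proper.
by rewrite ltNge => /negP; apply; apply: support_le => p; rewrite S0.
Qed.

Lemma eproper_finite : exists x0 M, f x0 = M%:E.
Proof.
have [[x fx] /(_ x)] := f_proper; move: fx.
by case fxE: (f x) => [M| |]// _ _; exists x, M.
Qed.

Lemma convex_lower_shift m : convex_set
  [set q : R * H | exists p t, [/\ S p, 0 <= t & q = (p.1 - t - m, p.2)]].
Proof.
move=> x y l; rewrite !inE => -[p [t [Sp t0 ->]]] [q [s [Sq s0 ->]]].
have l0 : 0 <= l%:num by [].
have l1 : l%:num <= 1 by [].
have [_ cS _] := hS.
exists (q + l%:num *: (p - q)), (s + l%:num * (t - s)); split.
- exact: convex_set_segment.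
- have -> : s + l%:num * (t - s) = (1 - l%:num) * s + l%:num * t by ring.
  by rewrite addr_ge0// mulr_ge0// subr_ge0.
- congr pair; first by rewrite /= /GRing.scale /= /unstable.onem; ring.
  by rewrite /= scalerBr scalerBl scale1r addrCA.
Qed.

(** Only approximate, since the shifted set is not known to be closed: its projection [p] lies in
    the closure, and p = 0 yields points of the set near the origin. *)
Lemma lower_bound_approx m (e : R) : (forall x, m%:E <= f x)%E -> 0 < e ->
  exists p, [/\ S p, m - e < p.1 & `|p.2| < e].
Proof.
move=> fm e0.
pose C := [set q : R * H |
  exists p t, [/\ S p, 0 <= t & q = (p.1 - t - m, p.2)]].
have [p0 Sp0] := support_nonempty.
have [|p Cp pC] := projection (@convex_lower_shift m).
  by exists (p0.1 - 0 - m, p0.2), p0, 0.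
have {}pC q t : S q -> 0 <= t -> pdot p p <= p.1 * (q.1 - t - m) + ip p.2 q.2.
  by move=> Sq t0; apply: (pC (q.1 - t - m, q.2)); exists q, t.
have p1 : p.1 <= 0.
  rewrite leNgt; apply/negP => p1.
  set K := p.1 * (p0.1 - m) + ip p.2 p0.2.
  (* Lowering [p0] by this amount turns its product with [p] into K - |K| - 1 < 0, which cannot
     bound <p, p> from above. *)
  have t0 : 0 <= (`|K| + 1) / p.1 by rewrite divr_ge0// ?ltW// addr_ge0.
  have := pC _ _ Sp0 t0; have := pdot_ge0 p; have := ler_norm K.
  have -> : p.1 * (p0.1 - (`|K| + 1) / p.1 - m) + ip p.2 p0.2 = K - `|K| - 1.
    have e1 : p.1 * ((`|K| + 1) / p.1) = `|K| + 1.
      by rewrite mulrC divfK// gt_eqF.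
    by rewrite -addrA (addrC (- _)) addrA mulrBr e1 /K; ring.
  lra.
have p_eq0 : p = 0.
  apply: pdot_eq0; rewrite leNgt; apply/negP => N0.
  move: p1; rewrite le_eqVlt => /orP[/eqP p1|p1].
    have [x0 [M fx0]] := eproper_finite.
    have mM : m <= M by rewrite -lee_fin -fx0.
    (* Each affine minorant drops by at least s <p, p> = M - m + 1 from [x0] to x0 - s p.2, so [f]
       falls from [M] to at most m - 1. *)
    pose s := (M - m + 1) / pdot p p.
    have s0 : 0 <= s by rewrite divr_ge0// ?ltW//; lra.
    have := fm (x0 - s *: p.2); rewrite leNgt => /negP; apply.
    apply: (@le_lt_trans _ _ (m - 1)%:E); last by rewrite lte_fin; lra.
    apply: support_le => q Sq; rewrite lee_fin linearB linearZ /=.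
    have := support_ub x0 Sq; rewrite fx0 lee_fin.
    have := pC _ _ Sq (lexx 0); rewrite p1 mul0r add0r ipC => h.
    have : s * pdot p p <= s * ip q.2 p.2 by rewrite ler_wpM2l.
    rewrite /s divfK ?gt_eqF// -/s; lra.
  (* Dividing the variational inequality by p.1 < 0 bounds every minorant at this point by m + <p,
     p> / p.1 < m. *)
  have := fm (p.1^-1 *: p.2); rewrite leNgt => /negP; apply.
  apply: (@le_lt_trans _ _ (m + pdot p p / p.1)%:E); last first.
    by rewrite lte_fin gtrDl pmulr_rlt0// invr_lt0.
  apply: support_le => q Sq; rewrite lee_fin linearZ /=.
  have := pC _ _ Sq (lexx 0); rewrite subr0 ipC => h.
  have : (q.1 - m) <= (pdot p p - ip q.2 p.2) / p.1.
    by rewrite ler_ndivlMr// mulrC lerBlDr.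
  rewrite mulrBl (mulrC (ip _ _)); lra.
(* Zero is in the closure, so q.1 - t - m is within [e] of 0; as t >= 0, only the lower bound on
   [q.1] survives. *)
have [_ [[q [t [Sq t0 ->]]]]] := Cp _ (nbhsx_ballx p e e0).
rewrite p_eq0 => -[] /=.
rewrite -ball_normE /= -ball_normE /= !sub0r !normrN => h1 h2.
exists q; split => //; move: h1; rewrite ltr_norml => /andP[]; lra.
Qed.

Lemma lower_bound_attained m : (forall x, m%:E <= f x)%E ->
  exists2 a, m <= a & S (a, 0).
Proof.
move=> fm; have [x0 [M fx0]] := eproper_finite; have [cS _ _] := hS.
(* The infimum of [B] is the limsup of [p.1] over points of [S] with [p.2] tending to 0; it is the
   height sought. *)
pose B : set R := [set b | exists2 e, 0 < e &
  forall p, S p -> `|p.2| < e -> p.1 <= b].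
have Bm b : B b -> m <= b.
  move=> [e e0 Be]; apply/ler_addgt0Pr => r r0.
  have er0 : 0 < Order.min e r by rewrite lt_min e0.
  have [p [Sp pm pe]] := lower_bound_approx fm er0.
  move: pe; rewrite lt_min => /andP[/(Be _ Sp) pb _].
  have : Order.min e r <= r by rewrite ge_min lexx orbT.
  lra.
have infB : has_inf B.
  split; last by exists m => b /Bm.
  (* Finiteness of [f] at [x0] bounds p.1 + <p.2, x0> by [M], and [ip_ge_sqr] with |p.2| <= 1
     absorbs the inner product. *)
  exists (M + (1 + `|x0| ^+ 2) / 2), 1 => // p Sp p1.
  have := support_ub x0 Sp; rewrite fx0 lee_fin.
  have := ip_ge_sqr p.2 x0.
  have : `|p.2| ^+ 2 <= 1 by rewrite expr_le1// ltW.
  lra.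
exists (inf B); first by apply: lb_le_inf; [exact: infB.1|move=> b /Bm].
rewrite (closure_id S).1// => U /nbhs_ballP[e /= e0 eU].
have [b [r r0 Br] bB] := inf_adherent e0 infB.
have er0 : 0 < Order.min e r by rewrite lt_min e0.
(* Otherwise inf B - e would itself belong to [B]. *)
have [p [Sp pe pB]] : exists p,
    [/\ S p, `|p.2| < Order.min e r & inf B - e < p.1].
  apply: contrapT => np.
  have : B (inf B - e).
    exists (Order.min e r) => // p Sp pe; rewrite leNgt; apply/negP => h.
    by apply: np; exists p.
  by move=> /(ge_inf infB.2); lra.
move: pe; rewrite lt_min => /andP[pe /(Br _ Sp) pb].
exists p; split => //; apply: eU; split; rewrite -ball_normE /=.
  by rewrite ltr_norml; apply/andP; split; lra.
by rewrite sub0r normrN.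
Qed.

(** * Infimum, minimizers and the point of minimal norm *)

Lemma bounded_below_horizontal : bounded_below f <-> horizontal S !=set0.
Proof.
split=> [[m /lower_bound_attained[a _ Sa]]|[[a v] [Sav [_ /= v0]]]].
  by exists (a, 0).
exists a => x; have := support_ub x Sav.
by rewrite /= v0 linear0l addr0.
Qed.

Lemma ge_height : (height S <= ereal_inf (range f))%E.
Proof.
apply: ge_ereal_sup => _ [a Sa <-]; apply: le_ereal_inf_tmp => _ [x _ <-].
by have := support_ub x Sa; rewrite /= linear0l addr0.
Qed.

(** The infimum is finite, and [lower_bound_attained] with [m] equal to it gives the nontrivial
    inequality. *)
Lemma height_inf : bounded_below f ->
  exists2 r, height S = r%:E & ereal_inf (range f) = r%:E.
Proof.
move=> [m fm]; have [x0 [M fx0]] := eproper_finite.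
have : (ereal_inf (range f) <= M%:E)%E.
  by rewrite -fx0; apply: ereal_inf_lbound; exists x0.
have : (m%:E <= ereal_inf (range f))%E.
  by apply: le_ereal_inf_tmp => _ [x _ <-].
case fr: (ereal_inf (range f)) => [r| |]// _ _; exists r => //.
apply/eqP; rewrite eq_le -{1}fr ge_height /=.
have [|a ra Sa] := @lower_bound_attained r.
  by move=> x; rewrite -fr; apply: ereal_inf_lbound; exists x.
by apply: (@le_trans _ _ a%:E);
  [rewrite lee_fin|apply: ereal_sup_ubound; exists a].
Qed.

(** For b > 0, dividing by b turns membership of (b, w) in the normal set into a + <v, w / b> <= inf
    f on [S], that is, f (w / b) <= inf f. *)
Lemma argmin_normal_set : argmin f =
  [set q.1^-1 *: q.2 | q in [set q | normal_set ip S q /\ 0 < q.1]].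
Proof.
apply/seteqP;
  split=> [x xmin|_ [q [[/bounded_below_horizontal bf qS] q0] <-]].
  have [r fx] : exists r, f x = r%:E.
    have [x0 [M fx0]] := eproper_finite; have := xmin x0; rewrite fx0.
    have [_ /(_ x)] := f_proper.
    by case fxE: (f x) => [r| |]// _ _; exists r.
  have bf : bounded_below f by exists r => y; rewrite -fx.
  have [s hs fs] := height_inf bf.
  have sr : s%:E = r%:E.
    rewrite -fs -fx; apply/eqP; rewrite eq_le; apply/andP; split.
      by apply: ereal_inf_lbound; exists x.
    by apply: le_ereal_inf_tmp => _ [y _ <-].
  exists (1, x); last by rewrite /= invr1 scale1r.
  split=> //; split=> [|p Sp]; first exact/bounded_below_horizontal.
  rewrite hs sr mul1e -EFinB -EFinD lee_fin /=.
  by have := support_ub x Sp; rewrite fx lee_fin ipC; lra.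
have [r hr fr] := height_inf bf.
move=> y; apply: (@le_trans _ _ r%:E).
  apply: support_le => p Sp; have := qS p Sp.
  rewrite hr -EFinB -EFinM -EFinD !lee_fin linearZ /= ipC => h.
  rewrite -lerBrDl ler_pdivrMl//; lra.
by rewrite -fr; apply: ereal_inf_lbound; exists y.
Qed.

(** The variational inequality yields |q - p|^2 <= |q|^2 - |p|^2, hence both minimality and
    uniqueness. *)
Lemma min_norm_projection p : S p -> (forall q, S q -> pdot p p <= pdot p q) ->
  min_norm S = [set p].
Proof.
move=> Sp pS.
have pq q : S q -> pdot (q - p) (q - p) <= pdot q q - pdot p p.
  move=> Sq; have := pS q Sq.
  by rewrite pdotBr 2!(pdotC (_ - _)) !pdotBr (pdotC q p); lra.
apply/seteqP; split=> [q [Sq qmin]|_ ->].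
  have := qmin p Sp; rewrite !norm2E => qp.
  apply/eqP; rewrite -subr_eq0; apply/eqP/pdot_eq0.
  by have := pq q Sq; lra.
split=> // q Sq; rewrite !norm2E.
by have := pq q Sq; have := pdot_ge0 (q - p); lra.
Qed.

End Support.
End InnerProduct.

Unset Implicit Arguments.
Set Strict Implicit.

Theorem proposition2 (R : realType) (H : completeNormedModType R)
    (ip : {dot H for idfun}) (hip : induces_norm ip)
    (f : H -> \bar R) (f_proper : eproper f)
    (f_closed : lower_semicontinuous f) (f_convex : econvex f)
    (S : set (R * H)) (hS : affine_support ip f S) :
  [/\ (* 1 *)
      bounded_below f <-> horizontal S !=set0,
      (* 2 *)
      bounded_below f -> height S = ereal_inf (range f),
      (* 3 *)
      (attains_min f <-> exists2 q, normal_set ip S q & 0 < q.1) /\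
      argmin f =
        [set q.1^-1 *: q.2 | q in [set q | normal_set ip S q /\ 0 < q.1]] &
      (* 4 *)
      exists p : R * H,
        [/\ min_norm S = [set p],
            (forall x, 0 <= f x)%E -> S (0, 0) \/ 0 < p.1,
            bounded_below f -> S (0, 0) \/ 0 < p.1 -> (forall x, 0 <= f x)%E &
            bounded_below f -> 0 < p.1 ->
              (0 < height S)%E /\ (0 < ereal_inf (range f))%E]].
Proof.
have [cS vS _] := hS.
have bh := bounded_below_horizontal hip f_proper hS.
have hi := height_inf hip f_proper hS.
have am := argmin_normal_set hip f_proper hS.
have [p clp pS] := projection hip vS (support_nonempty f_proper hS).
have {clp} Sp : S p by rewrite (closure_id S).1.
have horiz_pos : bounded_below f -> 0 < p.1 -> exists2 a, 0 < a & S (a, 0).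
  move=> /bh[[a v] [Sav [_ /= v0]]] p0; rewrite v0 in Sav; exists a => //.
  have := pS _ Sav; rewrite {2}/pdot /= linear0 addr0.
  have pp : 0 < pdot ip p p.
    rewrite pdot_normE//.
    have := sqr_ge0 `|p.2|; have := exprn_gt0 2 p0; lra.
  by move=> /(lt_le_trans pp); rewrite pmulr_rgt0.
split=> //.
- by move=> /hi[r -> ->].
- split=> //; split=> [[x xmin]|[q qN q0]].
    have : argmin f x by [].
    by rewrite am => -[q [qN q0] _]; exists q.
  exists (q.1^-1 *: q.2).
  suff : argmin f (q.1^-1 *: q.2) by [].
  by rewrite am; exists q.
exists p; split.
- exact: min_norm_projection pS.
(* The bound 0 gives (a, 0) in [S] with a >= 0; if p.1 <= 0 then <p, p> <= p.1 a <= 0, so the origin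
   is [p] itself. *)
- move=> /(lower_bound_attained hip f_proper hS)[a a0 Sa].
  have := pS _ Sa; rewrite {2}/pdot /= linear0 addr0 => pa.
  have [p0|p0] := ltP 0 p.1; [by right|left].
  have <- : p = (0, 0) => //.
  apply: (pdot_eq0 hip); apply: (le_trans pa).
  by rewrite mulr_le0_ge0.
- move=> bf [S0|/(horiz_pos bf)[a a0 Sa]] x.
    by have := support_ub hS x S0; rewrite /= linear0l addr0.
  have := support_ub hS x Sa; rewrite /= linear0l addr0.
  by apply: le_trans; rewrite lee_fin ltW.
- move=> bf /(horiz_pos bf)[a a0 Sa]; have [r hr fr] := hi bf.
  suff : (0 < height S)%E by rewrite hr fr.
  by apply: (@lt_le_trans _ _ a%:E);
    [rewrite lte_fin|apply: ereal_sup_ubound; exists a].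
Qed.
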